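(* Fix $\upsilon \in (0,1]$. Then the limit $\lim_{p\to\infty,\ p \text{ prime}} \rho(\upsilon,p)$ exists.
   Context: For an integer $N\ge 2$ and $f:\mathbb{Z}_N\to\mathbb{C}$ (where $\mathbb{Z}_N=\mathbb{Z}/N\mathbb{Z}$), define $\mathbb{E}(f)=\frac1N\sum_{n\in\mathbb{Z}_N} f(n)$ and $\Lambda_3(f)=\Lambda_3(f;N)=\frac{1}{N^2}\sum_{n,d\in\mathbb{Z}_N} f(n)f(n+d)f(n+2d)$. For $\upsilon\in(0,1]$ let $\mathcal{F}(\upsilon)=\mathcal{F}_N(\upsilon)$ be the family of all functions $f:\mathbb{Z}_N\to[0,1]$ with $\mathbb{E}(f)\ge \upsilon$, and define $\rho(\upsilon,N)=\min_{f\in\mathcal{F}_N(\upsilon)}\Lambda_3(f)$. *)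

(* Defs.v *)
From HB Require Import structures.
From mathcomp Require Import all_boot all_order all_algebra.
From mathcomp Require Import all_classical all_reals.
Set Implicit Arguments. Unset Strict Implicit. Unset Printing Implicit Defensive.
Import Order.TTheory GRing.Theory Num.Theory.
Local Open Scope ring_scope.
Local Open Scope classical_set_scope.

(* Z_N is 'Z_N (meaningful for N >= 2); functions take values in a realType R
   (the family F(upsilon) consists of [0,1]-valued functions). *)

Definition expect (R : realType) (N : nat) (f : 'Z_N -> R) : R :=
  (N%:R)^-1 * \sum_(n : 'Z_N) f n.

Definition Lambda3 (R : realType) (N : nat) (f : 'Z_N -> R) : R :=
  (N%:R ^+ 2)^-1 * \sum_(n : 'Z_N) \sum_(d : 'Z_N) f n * f (n + d) * f (n + d + d).

Definition famF (R : realType) (N : nat) (ups : R) : set ('Z_N -> R) :=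
  [set f | (forall n, 0 <= f n <= 1) /\ ups <= expect f].

(* rho(ups, N) = min over F_N(ups) of Lambda3; the min is attained
   (compactness), so it equals the infimum. *)
Definition rho (R : realType) (ups : R) (N : nat) : R :=
  inf [set Lambda3 f | f in @famF R N ups].

(* Main.v *)
Require Import Defs.
From HB Require Import structures.
From mathcomp Require Import all_boot all_order all_algebra.
From mathcomp Require Import all_classical all_reals.
From mathcomp Require Import complex lra ring zify.
Set Implicit Arguments. Unset Strict Implicit. Unset Printing Implicit Defensive.
Import Order.TTheory GRing.Theory Num.Theory.
Local Open Scope ring_scope.
Local Open Scope complex_scope.
Local Open Scope classical_set_scope.

(** Along primes [p <= q], [rho q <= rho p + eps] as soon as [p] is large in
    terms of [eps]; a bounded sequence with this property converges.

    Given [f] on [Z_p], the number of frequencies [a] with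
    [|fourier f a| >= delta * p] is bounded in terms of [delta] only (Parseval),
    so if [p] is large, Dirichlet's pigeonhole argument gives [t <> 0] with all
    these characters nearly [1] at [t].  Averaging [f] over
    [x, x + t, ..., x + (L - 1) t] then keeps its mean, hardly changes
    [Lambda3 = p^-3 * sum_a (fourier f a)^2 * fourier f (-2a)], and produces a
    function varying by at most [1/L] under the shift by [t]; after a dilation,
    under the shift by [1].  Such a slowly varying function is carried over to
    [Z_q] by viewing both [Z_p] and [Z_q] as partitions of [Z_pq] into
    intervals, of length [q] and [p] respectively, and taking the conditional
    expectation, which preserves the mean exactly. *)

(** * Characters and Fourier coefficients on [Z_p] *)

(** A root [w] of [1 + X + ... + X^(p-1)] satisfies [w ^+ p = 1], so its order divides the prime
    [p]. Order 1 would mean [w = 1], where the polynomial takes the nonzero value [p]. *)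
Lemma prime_primitive_root_exists (C : numClosedFieldType) (p : nat) :
  prime p -> exists w : C, p.-primitive_root w.
Proof.
move=> pr; have p1 := prime_gt1 pr.
have /closed_rootP[w] : size (\poly_(i < p) (1 : C)) != 1.
  by rewrite size_poly_eq ?oner_neq0 // gtn_eqF.
rewrite rootE horner_poly => /eqP w0.
have {w0} w0 : \sum_(i < p) w ^+ i = 0.
  by rewrite -[RHS]w0; apply: eq_bigr => i _; rewrite mul1r.
have wp : w ^+ p = 1 by apply/eqP; rewrite -subr_eq0 subrX1 w0 mulr0.
have [m mw] := prim_order_exists (prime_gt0 pr) wp.
case/primeP: (pr) => _ /[apply] /orP[] /eqP mE; last by exists w; rewrite -mE.
move: mw w0; rewrite mE => /prim_expr_order; rewrite expr1 => ->.
under eq_bigr do rewrite expr1n.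
by rewrite sumr_const card_ord => /eqP; rewrite pnatr_eq0 gtn_eqF // prime_gt0.
Qed.

Section Characters.
Variables (R : realType) (p : nat) (w : R[i]).
Hypotheses (p_gt1 : (1 < p)%N) (w_prim : p.-primitive_root w).

Definition chi (y : 'Z_p) : R[i] := w ^+ y.

Lemma chi_nat (n : nat) : chi n%:R = w ^+ n.
Proof. by rewrite /chi val_Zp_nat // prim_expr_mod. Qed.

Lemma chi0 : chi 0 = 1. Proof. by rewrite (chi_nat 0). Qed.

Lemma chiD x y : chi (x + y) = chi x * chi y.
Proof. by rewrite -(natr_Zp x) -(natr_Zp y) -natrD !chi_nat exprD. Qed.

Lemma chiMn x n : chi (x *+ n) = chi x ^+ n.
Proof. by rewrite -(natr_Zp x) -mulrnA !chi_nat exprM. Qed.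

Lemma norm_chi x : `|chi x| = 1.
Proof.
have p0 : (0 < p)%N by apply: ltnW.
apply/eqP; rewrite -(@pexpr_eq1 _ _ p) // -normrX -exprM mulnC exprM.
by rewrite (prim_expr_order w_prim) expr1n normr1.
Qed.

Lemma chi_neq0 x : chi x != 0.
Proof. by rewrite -normr_eq0 norm_chi oner_neq0. Qed.

Lemma norm_chiN_sub1 x : `|chi (- x) - 1| = `|chi x - 1|.
Proof.
have -> : chi (- x) - 1 = chi (- x) * (1 - chi x).
  by rewrite mulrBr mulr1 -chiD addNr chi0.
by rewrite normrM norm_chi mul1r distrC.
Qed.

(** The substitution of [1 + x] for [x] multiplies the sum by [chi a], which differs from 1 when
    [a != 0] because [w] is primitive. *)
Lemma sum_chi (a : 'Z_p) : \sum_(x : 'Z_p) chi (x * a) = if a == 0 then p%:R else 0.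
Proof.
case: eqVneq => [->|a0].
  under eq_bigr do rewrite mulr0 chi0.
  by rewrite sumr_const card_ord Zp_cast.
have /eqP : (chi a - 1) * \sum_(x : 'Z_p) chi (x * a) = 0.
  rewrite mulrBl mul1r mulr_sumr.
  under eq_bigr do rewrite -chiD -{1}[a]mul1r -mulrDl.
  by rewrite [X in _ - X](reindex_inj (addrI 1)) subrr.
rewrite mulf_eq0 subr_eq0 => /orP[|/eqP //].
rewrite -chi0 /chi (eq_prim_root_expr w_prim) mod0n.
have ap : (a < p)%N by rewrite -[X in (_ < X)%N](Zp_cast p_gt1).
by rewrite modn_small // -[_ == _]/(a == 0) (negPf a0).
Qed.

Definition fourier (f : 'Z_p -> R) (a : 'Z_p) : R[i] :=
  \sum_(x : 'Z_p) (f x)%:C * chi (x * a).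

Lemma parseval (f : 'Z_p -> R) :
  \sum_(a : 'Z_p) `|fourier f a| ^+ 2 = p%:R * \sum_(x : 'Z_p) (f x)%:C ^+ 2.
Proof.
(* Since [f] is real and characters have modulus 1, conjugation only replaces [a] by [- a] inside
   the character. *)
have conjF a : (fourier f a)^* = \sum_(y : 'Z_p) (f y)%:C * chi (y * - a).
  rewrite /fourier rmorph_sum; apply: eq_bigr => y _.
  have -> : chi (y * - a) = (chi (y * a))^*.
    apply: (mulfI (chi_neq0 (y * a))).
    by rewrite -sqr_normc norm_chi expr1n -chiD -mulrDr subrr mulr0 chi0.
  by rewrite rmorphM /= oppr0.
transitivity (\sum_(a : 'Z_p) \sum_(x : 'Z_p) \sum_(y : 'Z_p)
    (f x)%:C * (f y)%:C * chi (a * (x - y))).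
  apply: eq_bigr => a _; rewrite sqr_normc conjF mulr_suml.
  apply: eq_bigr => x _; rewrite mulr_sumr; apply: eq_bigr => y _.
  have -> : a * (x - y) = x * a + y * - a by ring.
  by rewrite chiD; ring.
rewrite exchange_big mulr_sumr; apply: eq_bigr => x _ /=.
rewrite exchange_big (bigD1 x) //= -mulr_sumr sum_chi subrr eqxx.
rewrite big1 ?addr0; first by ring.
by move=> y yx; rewrite -mulr_sumr sum_chi subr_eq0 eq_sym (negPf yx) mulr0.
Qed.

(** After expansion, summing over [a] keeps exactly the triples with [x + y = 2z], that is, the
    progressions [x, z, y] with difference [d = z - x]. The middle term carries the frequency
    [-2a]. *)
Lemma fourier_Lambda3 (f : 'Z_p -> R) :
  (Lambda3 f)%:C * p%:R ^+ 3 =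
  \sum_(a : 'Z_p) fourier f a ^+ 2 * fourier f (- (a *+ 2)).
Proof.
have p0 : (p%:R : R) != 0 by rewrite pnatr_eq0 -lt0n ltnW.
transitivity (\sum_(a : 'Z_p) \sum_(x : 'Z_p) \sum_(z : 'Z_p) \sum_(y : 'Z_p)
    (f x)%:C * (f z)%:C * (f y)%:C * chi (a * (x + y - z *+ 2))); last first.
  apply: eq_bigr => a _; rewrite expr2 -mulrA mulr_suml.
  apply: eq_bigr => x _; rewrite [X in _ * X]mulrC mulr_suml mulr_sumr.
  apply: eq_bigr => z _; rewrite 2!mulr_sumr; apply: eq_bigr => y _.
  have -> : a * (x + y - z *+ 2) = x * a + y * a + z * - (a *+ 2) by ring.
  by rewrite !chiD; ring.
have -> : (Lambda3 f)%:C * p%:R ^+ 3 = p%:R *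
    \sum_(x : 'Z_p) \sum_(z : 'Z_p) (f x)%:C * (f z)%:C * (f (z *+ 2 - x))%:C.
  have -> : p%:R = (p%:R : R)%:C :> R[i] by rewrite rmorph_nat.
  have -> : \sum_(x : 'Z_p) \sum_(z : 'Z_p) (f x)%:C * (f z)%:C * (f (z *+ 2 - x))%:C =
     (\sum_(x : 'Z_p) \sum_(z : 'Z_p) f x * f z * f (z *+ 2 - x))%:C.
    rewrite rmorph_sum; apply: eq_bigr => x _; rewrite rmorph_sum.
    by apply: eq_bigr => z _; rewrite !rmorphM.
  rewrite -rmorphXn -!rmorphM /Lambda3; congr (_%:C).
  rewrite mulrAC [p%:R ^+ 3]exprS mulrCA mulVf ?expf_neq0 // mulr1.
  congr (_ * _); apply: eq_bigr => x _.
  rewrite [RHS](reindex_inj (addrI x)); apply: eq_bigr => d _.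
  by congr (_ * f _); ring.
rewrite [RHS]exchange_big mulr_sumr; apply: eq_bigr => x _ /=.
rewrite [RHS]exchange_big mulr_sumr; apply: eq_bigr => z _ /=.
rewrite [RHS]exchange_big (bigD1 (z *+ 2 - x)) //= -mulr_sumr sum_chi.
rewrite subrKC subrr eqxx big1 ?addr0; first by ring.
by move=> y yx; rewrite -mulr_sumr sum_chi subr_eq0 addrC -(inj_eq (addIr (- x))) addrK
  (negPf yx) mulr0.
Qed.

Lemma norm_fourier_le (f : 'Z_p -> R) a : (forall x, 0 <= f x <= 1) ->
  `|fourier f a| <= p%:R.
Proof.
move=> f01; apply: le_trans (ler_norm_sum _ _ _) _.
rewrite -[X in X%:R](Zp_cast p_gt1) -[X in X%:R]card_ord -sumr_const.
apply: ler_sum => x _; rewrite normrM norm_chi mulr1.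
have /andP[f0 f1] := f01 x.
by rewrite ger0_norm ?ler0c // lecR.
Qed.

End Characters.

(** * Simultaneous approximation and smoothing *)

(** Index of the cell of length [1/K] containing [x] in [[-1, 1]]. The last of the [2K + 1] indices
    is reached only at [x = 1]. *)
Definition cell1 (R : realType) (K : nat) (x : R) : 'I_(2 * K).+1 :=
  inord (Num.trunc ((x + 1) * K%:R)).

Definition cell (R : realType) (K : nat) (z : R[i]) :=
  (cell1 K (complex.Re z), cell1 K (complex.Im z)).

Lemma cell1_dist (R : realType) (K : nat) (x y : R) : (0 < K)%N ->
  `|x| <= 1 -> `|y| <= 1 -> cell1 K x = cell1 K y -> `|x - y| <= K%:R^-1.
Proof.
move=> K0 /ler_normlP[x1 x2] /ler_normlP[y1 y2] /(congr1 val).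
have K0' : 0 < K%:R :> R by rewrite ltr0n.
have xK : 0 <= (x + 1) * K%:R by apply: mulr_ge0; lra.
have yK : 0 <= (y + 1) * K%:R by apply: mulr_ge0; lra.
rewrite /= !inordK ?truncn_lt_nat ?mulrSr ?natrM; [|nra..].
move=> xy; have := truncn_itv xK; have := truncn_itv yK; rewrite xy !mulrSr.
move=> /andP[y3 y4] /andP[x3 x4].
rewrite -(ler_pM2r K0') mulVf ?gt_eqF // -[X in _ * X]gtr0_norm // -normrM.
by apply/ler_normlP; split; lra.
Qed.

Lemma cell_dist (R : realType) (K : nat) (z z' : R[i]) : (0 < K)%N ->
  `|z| = 1 -> `|z'| = 1 -> cell K z = cell K z' -> `|z - z'| <= (2 / K%:R)%:C.
Proof.
move=> K0.
have coord (u : R[i]) : `|u| = 1 -> `|complex.Re u| <= 1 /\ `|complex.Im u| <= 1.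
  move=> u1; have := add_Re2_Im2 u; rewrite u1 expr1n => -[] uE.
  by split; apply/ler_normlP; split; nra.
move=> /coord[z1 z2] /coord[z3 z4] [/cell1_dist h1 /cell1_dist h2].
have {h1} := h1 K0 z1 z3; have {h2} := h2 K0 z2 z4.
rewrite normc_def lecR.
case: z z' {z1 z2 z3 z4} => a b [c d] /=.
set k : R := K%:R^-1.
have k0 : 0 <= k by rewrite invr_ge0.
move=> /ler_normlP[h1 h2] /ler_normlP[h3 h4].
(* The distance is at most [sqrt 2 / K]; the cruder constant 2 makes the right-hand side the root of
   a perfect square. *)
rewrite -[leRHS]ger0_norm; last by rewrite mulr_ge0.
rewrite -sqrtr_sqr; apply: ler_wsqrtr; nra.
Qed.

(* Pigeonhole: two of the [p] tuples [(chi w (a * s))_(a in A)], say for [s] and [s'],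
   lie in the same product of cells, and [t = s - s']. *)
Lemma simultaneous_return (R : realType) (p : nat) (w : R[i]) (K k : nat)
    (A : {set 'Z_p}) : (1 < p)%N -> p.-primitive_root w -> (0 < K)%N ->
  (#|A| <= k)%N -> ((((2 * K).+1) ^ 2) ^ k < p)%N ->
  exists2 t : 'Z_p, t != 0 &
    forall a, a \in A -> `|chi w (a * t) - 1| <= (2 / K%:R)%:C.
Proof.
move=> p1 wp K0 Ak Kp.
(* The fixed value [y0] outside [A] leaves only [#|A|] free coordinates, so the exponent in the
   count is [#|A|] and not [p]. *)
pose y0 : 'I_(2 * K).+1 * 'I_(2 * K).+1 := (ord0, ord0).
pose F (s : 'Z_p) := [ffun a : 'Z_p => if a \in A then cell K (chi w (a * s)) else y0].
have /injectivePn[s [s' ss' Fss']] : ~~ injectiveb F.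
  apply/negP => /injectiveP Finj; move: Kp; rewrite ltnNge => /negP; apply.
  rewrite -[X in (X <= _)%N](Zp_cast p1) -[X in (X <= _)%N]card_ord -(card_codom Finj).
  have /subset_leq_card/leq_trans -> // : codom F \subset pffun_on y0 (mem A) predT.
    apply/fintype.subsetP => _ /codomP[s ->]; apply/pffun_onP; split => //.
    by apply/fintype.subsetP => a; rewrite inE ffunE; case: ifP => //; rewrite eqxx.
  rewrite card_pffun_on card_prod !card_ord mulnn.
  by rewrite leq_pexp2l // expn_gt0.
exists (s - s'); first by rewrite subr_eq0.
move=> a aA; move/ffunP/(_ a): Fss'; rewrite !ffunE aA => ss'_cell.
have := cell_dist K0 (norm_chi p1 wp _) (norm_chi p1 wp _) ss'_cell.
apply: le_trans.
(* Multiplication by the unimodular [chi w (- (a * s'))] turns the distance between the characters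
   at [s] and [s'] into the distance from 1 at [s - s']. *)
rewrite -[leRHS]mulr1 -[X in _ <= _ * X](norm_chi p1 wp (- (a * s'))) -normrM mulrBl.
by rewrite -!(chiD p1 wp) subrr (chi0 p1 wp) -mulrBr.
Qed.

Lemma norm_exprn_sub1 (C : numDomainType) (u : C) (j : nat) :
  `|u| = 1 -> `|u ^+ j - 1| <= j%:R * `|u - 1|.
Proof.
move=> u1; rewrite subrX1 normrM mulrC ler_wpM2r //.
apply: le_trans (ler_norm_sum _ _ _) _.
under eq_bigr do rewrite normrX u1 expr1n.
by rewrite sumr_const card_ord.
Qed.

(** * Averaging along progressions of step [t] *)

Definition smooth (R : realType) (p : nat) (t : 'Z_p) (L : nat) (f : 'Z_p -> R) (x : 'Z_p) : R :=
  L%:R^-1 * \sum_(j < L) f (x + t *+ j).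

Section Smooth.
Variables (R : realType) (p : nat) (t : 'Z_p) (L : nat) (f : 'Z_p -> R).
Hypotheses (L0 : (0 < L)%N) (f01 : forall x, 0 <= f x <= 1).
Let L0' : 0 < L%:R :> R. Proof. by rewrite ltr0n. Qed.

Lemma smooth01 x : 0 <= smooth t L f x <= 1.
Proof.
apply/andP; split.
  by rewrite mulr_ge0 ?invr_ge0 ?ler0n // sumr_ge0 // => j _; case/andP: (f01 (x + t *+ j)).
rewrite /smooth mulrC ler_pdivrMr // mul1r -[X in X%:R]card_ord -sumr_const.
by apply: ler_sum => j _; case/andP: (f01 (x + t *+ j)).
Qed.

Lemma expect_smooth : expect (smooth t L f) = expect f.
Proof.
rewrite /expect /smooth -mulr_sumr exchange_big /=; congr (_ * _).
have shift (j : 'I_L) : \sum_(x : 'Z_p) f (x + t *+ j) = \sum_(x : 'Z_p) f x.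
  by rewrite [RHS](reindex_inj (addIr (t *+ j))).
by rewrite (eq_bigr _ (fun j _ => shift j)) sumr_const card_ord -[X in _ * X]mulr_natl
  mulrA mulVf ?mul1r ?gt_eqF.
Qed.

(** A shift by [t] moves the window of [L] terms by one place, so the difference telescopes to the
    two end values, both in [[0, 1]]. *)
Lemma smooth_slow x : `|smooth t L f (x + t) - smooth t L f x| <= L%:R^-1.
Proof.
rewrite /smooth -mulrBr normrM gtr0_norm ?invr_gt0 // -[leRHS]mulr1.
rewrite ler_wpM2l ?invr_ge0 ?ler0n //.
have -> : \sum_(j < L) f (x + t + t *+ j) - \sum_(j < L) f (x + t *+ j) =
    f (x + t *+ L) - f x.
  rewrite -sumrB -(big_mkord xpredT (fun j => f (x + t + t *+ j) - f (x + t *+ j))).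
  under eq_bigr do rewrite -addrA -mulrS.
  by rewrite telescope_sumr // mulr0n addr0.
have /andP[a b] := f01 (x + t *+ L); have /andP[c d] := f01 x.
by apply/ler_normlP; split; lra.
Qed.

End Smooth.

Section SmoothFourier.
Variables (R : realType) (p : nat) (w : R[i]) (t : 'Z_p) (L : nat).
Hypotheses (p_gt1 : (1 < p)%N) (w_prim : p.-primitive_root w) (L0 : (0 < L)%N).

(** Smoothing is a convolution, so it acts diagonally on Fourier coefficients; this is its
    eigenvalue at [a]. The minus sign comes from substituting [x - t *+ j] for [x]. *)
Definition smoothing_multiplier (a : 'Z_p) : R[i] :=
  L%:R^-1 * \sum_(j < L) chi w (- (a * t *+ j)).
Local Notation m := smoothing_multiplier.

Lemma fourier_smooth (f : 'Z_p -> R) a :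
  fourier w (smooth t L f) a = fourier w f a * m a.
Proof.
rewrite /fourier /smooth /m mulrCA mulr_sumr mulr_sumr.
transitivity (L%:R^-1 * \sum_(x : 'Z_p) \sum_(j < L) (f (x + t *+ j))%:C * chi w (x * a)).
  rewrite mulr_sumr; apply: eq_bigr => x _.
  rewrite rmorphM rmorph_sum fmorphV rmorph_nat -mulrA; congr (_ * _).
  by rewrite mulr_suml.
rewrite exchange_big mulr_sumr; apply: eq_bigr => j _; congr (_ * _).
rewrite mulr_suml [RHS](reindex_inj (addIr (t *+ j))); apply: eq_bigr => x _.
rewrite -mulrA -chiD //; congr (_ * chi w _).
by rewrite -mulrnAr mulrDl [a * _]mulrC addrK.
Qed.

Lemma norm_multiplier_le1 a : `|m a| <= 1.
Proof.
have L0' : 0 < L%:R :> R[i] by rewrite ltr0n.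
rewrite normrM gtr0_norm ?invr_gt0 // mulrC ler_pdivrMr // mul1r.
apply: le_trans (ler_norm_sum _ _ _) _.
under eq_bigr do rewrite norm_chi //.
by rewrite sumr_const card_ord.
Qed.

(** The [j]-th term of the average is a [j]-th power of a unimodular number within [eta] of 1, so it
    is within [j * eta] of 1, and [j < L]. *)
Lemma multiplier_dist1 a (eta : R) : `|chi w (a * t) - 1| <= eta%:C ->
  `|1 - m a| <= (L%:R * eta)%:C.
Proof.
move=> at_eta.
have L0' : 0 < L%:R :> R[i] by rewrite ltr0n.
have -> : 1 - m a = L%:R^-1 * \sum_(j < L) (1 - chi w (- (a * t *+ j))).
  rewrite sumrB mulrBr; congr (_ - _).
  by rewrite sumr_const card_ord mulVf ?gt_eqF.
rewrite normrM gtr0_norm ?invr_gt0 // mulrC ler_pdivrMr //.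
apply: le_trans (ler_norm_sum _ _ _) _.
rewrite mulr_natr -[X in _ <= _ *+ X](card_ord L) -sumr_const; apply: ler_sum => j _.
rewrite distrC norm_chiN_sub1 // chiMn //.
apply: le_trans (norm_exprn_sub1 _ _) _; first by rewrite norm_chi.
rewrite rmorphM rmorph_nat ler_pM // ler_nat ltnW //.
Qed.

End SmoothFourier.

(** The modulus as an element of [R]: the norm of [R[i]] takes values in [R[i]], whereas the
    estimates below are real inequalities. *)
Definition absC (R : realType) (z : R[i]) : R := complex.Re `|z|.

Lemma absCE (R : realType) (z : R[i]) : `|z| = (absC z)%:C.
Proof. by rewrite /absC normc_def. Qed.

Lemma absC_ge0 (R : realType) (z : R[i]) : 0 <= absC z.
Proof. by rewrite -lecR -absCE normr_ge0. Qed.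

Lemma unit_Zp_prime (p : nat) (t : 'Z_p) : prime p -> t != 0 -> t \is a GRing.unit.
Proof.
move=> pr t0; have p1 := prime_gt1 pr.
have tp : (t < p)%N by rewrite -[X in (_ < X)%N](Zp_cast p1).
rewrite -(natr_Zp t) unitZpE // prime_coprime // gtnNdvd // lt0n.
by apply: contra t0 => /eqP t0; apply/eqP/val_inj.
Qed.

(** * Change of [Lambda3] under smoothing *)

Section SmoothLambda3.
Variables (R : realType) (p : nat) (w : R[i]) (f : 'Z_p -> R).
Hypotheses (p_gt1 : (1 < p)%N) (w_prim : p.-primitive_root w).
Hypothesis f01 : forall x, 0 <= f x <= 1.
Local Notation ampl a := (absC (fourier w f a)).
Let p0 : 0 < p%:R :> R. Proof. by rewrite ltr0n ltnW. Qed.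

Lemma absC_fourier_le a : ampl a <= p%:R.
Proof. by rewrite -lecR -absCE rmorph_nat norm_fourier_le. Qed.

Lemma sum_absC_fourier_le : \sum_(a : 'Z_p) ampl a ^+ 2 <= p%:R ^+ 2.
Proof.
have -> : \sum_(a : 'Z_p) ampl a ^+ 2 = p%:R * \sum_(x : 'Z_p) f x ^+ 2.
  suff [] : (\sum_(a : 'Z_p) ampl a ^+ 2)%:C = (p%:R * \sum_(x : 'Z_p) f x ^+ 2)%:C by [].
  rewrite rmorphM !rmorph_sum rmorph_nat; transitivity (\sum_(a : 'Z_p) `|fourier w f a| ^+ 2).
    by apply: eq_bigr => a _; rewrite absCE rmorphXn.
  by rewrite parseval //; congr (_ * _); apply: eq_bigr => x _; rewrite rmorphXn.
rewrite expr2 ler_wpM2l ?ler0n // -[X in X%:R](Zp_cast p_gt1) -[X in X%:R]card_ord.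
rewrite -sumr_const; apply: ler_sum => x _.
by have /andP[f0 f1] := f01 x; apply: exprn_ile1.
Qed.

(** Chebyshev's inequality: each such frequency contributes at least [(delta * p)^2] to a sum that
    Parseval bounds by [p^2]. *)
Lemma card_large_spectrum (delta : R) : 0 < delta ->
  #|[set a : 'Z_p | delta * p%:R <= ampl a]%SET|%:R <= (delta ^+ 2)^-1.
Proof.
move=> d0; set A := [set a | _]%SET.
rewrite -[leRHS]mul1r ler_pdivlMr ?exprn_gt0 // -(ler_pM2r (exprn_gt0 2 p0)) mul1r.
apply: le_trans sum_absC_fourier_le.
rewrite -mulrA -exprMn mulr_natl -sumr_const [leRHS](bigID (mem A)) /=.
rewrite -[leLHS]addr0 lerD ?sumr_ge0 // => [|a _]; last exact: exprn_ge0 (absC_ge0 _).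
apply: ler_sum => a; rewrite inE => aA.
by rewrite lerXn2r // nnegrE ?absC_ge0 // mulr_ge0 ?ltW.
Qed.

(** Smoothing multiplies the term at [a] of the Fourier expansion by [m a ^+ 2 * m (- (a *+ 2))].
    This factor is close to 1 when both [a] and [-2a] are large frequencies; otherwise one Fourier
    coefficient is below [delta * p], and Parseval controls the rest. *)
Lemma Lambda3_smooth (t : 'Z_p) (L : nat) (delta eta : R) :
  prime p -> (2 < p)%N -> (0 < L)%N -> 0 < delta -> 0 <= eta ->
  (forall a, delta * p%:R <= ampl a -> `|chi w (a * t) - 1| <= eta%:C) ->
  `|Lambda3 f - Lambda3 (smooth t L f)| <= 2 * (3 * (L%:R * eta) + 2 * delta).
Proof.
move=> pr p2 L0 d0 eta0 large.
set e1 := L%:R * eta; have e10 : 0 <= e1 by rewrite mulr_ge0.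
pose m a := smoothing_multiplier w t L a.
pose D a := absC (1 - m a ^+ 2 * m (- (a *+ 2))).
have m1 a : `|m a| <= 1 by exact: norm_multiplier_le1.
have m2 a : delta * p%:R <= ampl a -> `|1 - m a| <= e1%:C.
  by move=> /large; exact: multiplier_dist1.
have D2 a : D a <= 2.
  rewrite -lecR -absCE rmorph_nat; apply: le_trans (ler_normB _ _) _.
  rewrite normr1 -[2]/(1 + 1) lerD2l normrM normrX.
  by rewrite mulr_ile1 ?exprn_ge0 ?exprn_ile1.
have D3 a : delta * p%:R <= ampl a -> delta * p%:R <= ampl (- (a *+ 2)) -> D a <= 3 * e1.
  move=> /m2 ma /m2 mb; rewrite -lecR -absCE.
  have -> : 1 - m a ^+ 2 * m (- (a *+ 2)) =
     (1 - m a) + m a * (1 - m a) + m a ^+ 2 * (1 - m (- (a *+ 2))) by ring.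
  have -> : (3 * e1)%:C = e1%:C + 1 * e1%:C + 1 * e1%:C.
    by rewrite !mul1r -!rmorphD; congr (_%:C); ring.
  apply: le_trans (ler_normD _ _) _; apply: lerD; last first.
    by rewrite normrM ler_pM // normrX exprn_ile1.
  apply: le_trans (ler_normD _ _) _; apply: lerD => //.
  by rewrite normrM ler_pM.
(* The right-hand side is made of squares so that it can be summed by Parseval. In the small case,
   one factor is at most [delta * p], the other two have product at most the sum of squares, and
   [D a <= 2]. *)
have pointwise a : ampl a ^+ 2 * ampl (- (a *+ 2)) * D a <=
    p%:R * (3 * e1 + 2 * delta) * (ampl a ^+ 2 + ampl (- (a *+ 2)) ^+ 2).
  have D0 : 0 <= D a by exact: absC_ge0.
  have := D2 a; have := D3 a; have := absC_fourier_le a; have := absC_fourier_le (- (a *+ 2)).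
  have := absC_ge0 (fourier w f a); have := absC_ge0 (fourier w f (- (a *+ 2))).
  move: (ampl a) (ampl (- (a *+ 2))) (D a) D0 => x y d d_ge0 y0 x0 yp xp d3 d2.
  have cross : x * y <= x ^+ 2 + y ^+ 2 by nra.
  have q0 : 0 <= x ^+ 2 + y ^+ 2 by rewrite addr_ge0 ?sqr_ge0.
  have e1q : 0 <= p%:R * e1 * (x ^+ 2 + y ^+ 2) by rewrite !mulr_ge0 // ltW.
  have dq : 0 <= p%:R * delta * (x ^+ 2 + y ^+ 2) by rewrite !mulr_ge0 // ltW.
  have step z u : 0 <= z -> 0 <= u -> z <= delta * p%:R -> u <= x ^+ 2 + y ^+ 2 ->
      z * u * d <= 2 * (p%:R * delta * (x ^+ 2 + y ^+ 2)).
    move=> z0 u0 zd uq; rewrite mulrC ler_pM ?mulr_ge0 //.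
    by rewrite [p%:R * _]mulrC ler_pM.
  case: (leP (delta * p%:R) x) => [hx|/ltW hx]; last first.
    have := step x (x * y) x0 (mulr_ge0 x0 y0) hx cross; lra.
  case: (leP (delta * p%:R) y) => [hy|/ltW hy]; last first.
    have := step y (x ^+ 2) y0 (sqr_ge0 _) hy; nra.
  have {}d3 := d3 hx hy.
  have : x ^+ 2 * y * d <= (x ^+ 2 + y ^+ 2) * p%:R * (3 * e1).
    rewrite ler_pM // ?mulr_ge0 ?sqr_ge0 // ler_pM ?sqr_ge0 //.
    by rewrite lerDl sqr_ge0.
  lra.
(* As [p] is odd, [a -> -2a] permutes the frequencies, so both families of squares have the same
   sum; this gives the outer factor 2 of the bound. *)
have two_unit : (2%:R : 'Z_p) \is a GRing.unit.
  by rewrite unitZpE // coprime_sym prime_coprime // dvdn_prime2 // ltn_eqF.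
have dbl_inj : injective (fun a : 'Z_p => - (a *+ 2)).
  by move=> a b /oppr_inj; rewrite -[a *+ 2]mulr_natr -[b *+ 2]mulr_natr => /(mulIr two_unit).
have total : `|Lambda3 f - Lambda3 (smooth t L f)| * p%:R ^+ 3 <=
    \sum_(a : 'Z_p) ampl a ^+ 2 * ampl (- (a *+ 2)) * D a.
  rewrite -lecR rmorphM rmorphXn rmorph_nat rmorph_sum /=.
  have -> : `|Lambda3 f - Lambda3 (smooth t L f)|%:C * p%:R ^+ 3 =
      `|((Lambda3 f)%:C - (Lambda3 (smooth t L f))%:C) * p%:R ^+ 3|.
    rewrite normrM normrX normr_nat; congr (_ * _).
    by rewrite -rmorphB normc_def /= expr0n /= addr0 sqrtr_sqr.
  rewrite mulrBl !(fourier_Lambda3 p_gt1 w_prim) -sumrB.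
  apply: le_trans (ler_norm_sum _ _ _) _; apply: ler_sum => a _.
  rewrite !fourier_smooth // !rmorphM /= -!absCE.
  rewrite -!normrM le_eqVlt; apply/orP; left; apply/eqP; congr `|_|.
  by rewrite -/(m _) -/(m _); ring.
rewrite -(ler_pM2r (exprn_gt0 3 p0)); apply: le_trans total _.
apply: le_trans (ler_sum _ (fun a _ => pointwise a)) _.
have reindexed : \sum_(a : 'Z_p) ampl (- (a *+ 2)) ^+ 2 = \sum_(a : 'Z_p) ampl a ^+ 2.
  by rewrite [RHS](reindex_inj dbl_inj).
rewrite -mulr_sumr big_split /= reindexed.
have := sum_absC_fourier_le; set S := \sum_(a : 'Z_p) _ => Sp.
have c0 : 0 <= p%:R * (3 * e1 + 2 * delta) by rewrite mulr_ge0 ?ltW //; lra.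
have := ler_wpM2l c0 (lerD Sp Sp); rewrite !exprS expr0 mulr1; lra.
Qed.

End SmoothLambda3.

(** * Choice of parameters and dilation *)

Lemma invr_truncnS_le (R : realType) (x : R) :
  0 < x -> ((Num.trunc x^-1).+1%:R)^-1 <= x.
Proof.
move=> x0; have x0' : 0 < x^-1 by rewrite invr_gt0.
rewrite -[leRHS]invrK lef_pV2 ?posrE ?ltr0n //.
by case/andP: (truncn_itv (ltW x0')) => _ /ltW.
Qed.

Lemma slow_smoothing_exists (R : realType) (eps : R) : 0 < eps ->
  exists M : nat, forall p : nat, prime p -> (M <= p)%N ->
    forall f : 'Z_p -> R, (forall x, 0 <= f x <= 1) ->
    exists (t : 'Z_p) (L : nat), [/\ t != 0, (0 < L)%N, L%:R^-1 <= eps &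
      `|Lambda3 f - Lambda3 (smooth t L f)| <= eps].
Proof.
move=> e0.
(* With [eta = 2 / K] the final error is [12 * L / K + 4 * delta]; [K] and [delta] make each summand
   at most [eps / 2]. The integer [k] bounds the number of large frequencies. *)
pose L := (Num.trunc eps^-1).+1.
have L0 : 0 < L%:R :> R by rewrite ltr0n.
pose K := (Num.trunc (eps / (24 * L%:R))^-1).+1.
pose delta := eps / 8; have d0 : 0 < delta by rewrite /delta; lra.
pose k := (Num.trunc (delta ^+ 2)^-1).
(* The 3 makes [p] odd, and the other bound is what the pigeonhole principle requires; neither
   depends on [p] or [f]. *)
exists (maxn 3 (((2 * K).+1 ^ 2) ^ k).+1) => p pr.
rewrite geq_max => /andP[p3 pM] f f01.
have p1 := prime_gt1 pr.
have [w wp] := prime_primitive_root_exists R[i]%C pr.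
set A := [set a : 'Z_p | delta * p%:R <= absC (fourier w f a)]%SET.
have Ak : (#|A| <= k)%N.
  rewrite truncn_ge_nat ?invr_ge0 ?sqr_ge0 //.
  exact: (card_large_spectrum p1 wp f01 d0).
have [t t0 tA] := simultaneous_return (K := K) p1 wp isT Ak pM.
exists t, L; split => //; first exact: invr_truncnS_le.
have eta0 : 0 <= 2 / K%:R :> R by rewrite divr_ge0.
have large a : delta * p%:R <= absC (fourier w f a) ->
    `|chi w (a * t) - 1| <= (2 / K%:R)%:C%C.
  by move=> aA; apply: tA; rewrite inE.
apply: le_trans (Lambda3_smooth p1 wp f01 pr p3 _ d0 eta0 large) _ => //.
have : K%:R^-1 <= eps / (24 * L%:R).
  by apply: invr_truncnS_le; rewrite divr_gt0 // mulr_gt0.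
rewrite ler_pdivlMr ?mulr_gt0 // /delta; nra.
Qed.

Lemma expect_dilate (R : realType) (p : nat) (f : 'Z_p -> R) (t : 'Z_p) :
  t \is a GRing.unit -> expect (fun x => f (x * t)) = expect f.
Proof. by move=> tU; rewrite /expect [in RHS](reindex_inj (mulIr tU)). Qed.

(** Multiplication by a unit permutes the pairs [(n, d)]. With such a dilation, slow variation under
    the shift by [t] becomes slow variation under the shift by 1. *)
Lemma Lambda3_dilate (R : realType) (p : nat) (f : 'Z_p -> R) (t : 'Z_p) :
  t \is a GRing.unit -> Lambda3 (fun x => f (x * t)) = Lambda3 f.
Proof.
move=> tU; rewrite /Lambda3; congr (_ * _).
rewrite [RHS](reindex_inj (mulIr tU)); apply: eq_bigr => n _.
rewrite [RHS](reindex_inj (mulIr tU)); apply: eq_bigr => d _.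
by rewrite !mulrDl.
Qed.

Lemma slow_approximation (R : realType) (eps : R) : 0 < eps ->
  exists M : nat, forall p : nat, prime p -> (M <= p)%N ->
    forall f : 'Z_p -> R, (forall x, 0 <= f x <= 1) ->
    exists h : 'Z_p -> R, [/\ forall x, 0 <= h x <= 1, expect h = expect f,
      forall x, `|h (x + 1) - h x| <= eps & `|Lambda3 f - Lambda3 h| <= eps].
Proof.
move=> /slow_smoothing_exists[M HM]; exists M => p pr Mp f f01.
have [t [L [t0 L0 Le fe]]] := HM p pr Mp f f01.
have tU := unit_Zp_prime pr t0.
exists (fun x => smooth t L f (x * t)); split.
- by move=> x; exact: smooth01.
- by rewrite expect_dilate // expect_smooth.
- move=> x; rewrite mulrDl mul1r; apply: le_trans Le; exact: smooth_slow.
- by rewrite Lambda3_dilate.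
Qed.

(** * From [Z_p] to [Z_q] *)

(** Unnormalised [Lambda3] of a function on the naturals. Indices are not reduced modulo [N], so
    they can be cut into blocks by Euclidean division. *)
Definition ap3 (R : realType) (N : nat) (H : nat -> R) : R :=
  \sum_(0 <= n < N) \sum_(0 <= d < N) H n * H (n + d)%N * H (n + d + d)%N.

Lemma sum_Zp (R : realType) (N : nat) (F : 'Z_N -> R) : (1 < N)%N ->
  \sum_(x : 'Z_N) F x = \sum_(0 <= i < N) F i%:R.
Proof.
move=> N1; rewrite -[X in \sum_(0 <= i < X) _](Zp_cast N1) big_mkord.
by apply: eq_bigr => i _; rewrite natr_Zp.
Qed.

Lemma Lambda3_ap3 (R : realType) (N : nat) (f : 'Z_N -> R) : (1 < N)%N ->
  Lambda3 f = (N%:R ^+ 2)^-1 * ap3 N (fun n => f n%:R).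
Proof.
move=> N1; rewrite /Lambda3 /ap3 sum_Zp //; congr (_ * _).
by apply: eq_bigr => n _; rewrite sum_Zp //; apply: eq_bigr => d _; rewrite !natrD.
Qed.

Lemma sum_blocks (R : realType) (N k : nat) (G : nat -> R) :
  \sum_(0 <= x < N * k) G x = \sum_(0 <= a < N) \sum_(0 <= r < k) G (a * k + r)%N.
Proof.
elim: N => [|N IH]; first by rewrite mul0n !big_geq.
rewrite mulSnr (@big_cat_nat _ _ _ (N * k)) ?leq_addr //= big_nat_recr //= IH.
congr (_ + _); rewrite -{1}[(N * k)%N]add0n big_addn addKn.
by apply: eq_bigr => r _; rewrite addnC.
Qed.

Lemma dist_sum2_le (R : realType) (N M : nat) (F G : nat -> nat -> R) (c : R) :
  (forall i j, (i < N)%N -> (j < M)%N -> `|F i j - G i j| <= c) ->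
  `|\sum_(0 <= i < N) \sum_(0 <= j < M) F i j -
    \sum_(0 <= i < N) \sum_(0 <= j < M) G i j| <= N%:R * M%:R * c.
Proof.
move=> FG; rewrite -sumrB; apply: le_trans (ler_norm_sum _ _ _) _.
have -> : N%:R * M%:R * c = \sum_(0 <= i < N) \sum_(0 <= j < M) c.
  by rewrite !sumr_const_nat !subn0; ring.
rewrite [leLHS]big_nat [leRHS]big_nat; apply: ler_sum => i /= iN.
rewrite -sumrB; apply: le_trans (ler_norm_sum _ _ _) _.
by rewrite [leLHS]big_nat [leRHS]big_nat; apply: ler_sum => j /= jM; apply: FG.
Qed.

Lemma dist_prod3_le (R : realType) (a b c a' b' c' : R) :
  0 <= a <= 1 -> 0 <= b <= 1 -> 0 <= c <= 1 ->
  0 <= a' <= 1 -> 0 <= b' <= 1 -> 0 <= c' <= 1 ->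
  `|a * b * c - a' * b' * c'| <= `|a - a'| + `|b - b'| + `|c - c'|.
Proof.
move=> /andP[a0 a1] /andP[b0 b1] /andP[c0 c1] /andP[a0' a1'] /andP[b0' b1'] /andP[c0' c1'].
have -> : a * b * c - a' * b' * c' =
  (a - a') * (b * c) + (b - b') * (a' * c) + (c - c') * (a' * b') by ring.
have scale (u v w : R) : 0 <= v -> v <= 1 -> 0 <= w -> w <= 1 -> `|u * (v * w)| <= `|u|.
  move=> v0 v1 w0 w1; rewrite normrM -[leRHS]mulr1 ler_wpM2l //.
  by rewrite ger0_norm ?mulr_ge0 // mulr_ile1.
apply: le_trans (ler_normD _ _) _; apply: lerD; last exact: scale.
by apply: le_trans (ler_normD _ _) _; apply: lerD; exact: scale.
Qed.

Section Slow.
Variables (R : realType) (e : R) (H : nat -> R).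
Hypotheses (H01 : forall n, 0 <= H n <= 1) (Hslow : forall n, `|H n.+1 - H n| <= e).

Lemma slow_ge0 : 0 <= e.
Proof. exact: le_trans (normr_ge0 _) (Hslow 0). Qed.

Lemma slow_add n j : `|H n - H (n + j)%N| <= j%:R * e.
Proof.
elim: j => [|j IH]; first by rewrite addn0 subrr normr0 mul0r.
have h := Hslow (n + j); rewrite distrC in h.
have := ler_distD (H (n + j)%N) (H n) (H (n + j.+1)%N).
rewrite addnS mulrSr; lra.
Qed.

Lemma slow_add_le n j k : (j <= k)%N -> `|H n - H (n + j)%N| <= k%:R * e.
Proof.
move=> jk; apply: le_trans (slow_add n j) _.
by rewrite ler_wpM2r ?slow_ge0 // ler_nat.
Qed.

(** Points at distance at most [q] lie in the same or in consecutive intervals of length [q]. *)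
Lemma slow_divn q u v : (0 < q)%N -> (u <= v <= u + q)%N ->
  `|H (u %/ q) - H (v %/ q)| <= e.
Proof.
move=> q0 /andP[uv vu].
have h1 : (u %/ q <= v %/ q)%N by apply: leq_div2r.
have h2 : (v %/ q <= u %/ q + 1)%N.
  have -> : (u %/ q + 1 = (u + q) %/ q)%N by rewrite divnDr ?dvdnn // divnn q0.
  exact: leq_div2r.
have := @slow_add_le (u %/ q) (v %/ q - u %/ q) 1; rewrite subnKC // mul1r; apply.
lia.
Qed.

(** Write the first term as [a * k + r] and the difference as [b * k + s]. The carries from [r + s]
    and [r + s + s] are at most 1 and 2, so the three factors move by at most [0], [e] and [2e]. *)
Lemma ap3_blocks (N k : nat) : (0 < k)%N ->
  `|ap3 (N * k) (fun x => H (x %/ k)) - k%:R ^+ 2 * ap3 N H| <=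
  3 * e * (N * k)%:R ^+ 2.
Proof.
move=> k0.
pose T a r b s := H ((a * k + r) %/ k)%N * H ((a * k + r + (b * k + s)) %/ k)%N *
  H ((a * k + r + (b * k + s) + (b * k + s)) %/ k)%N.
have -> : ap3 (N * k) (fun x => H (x %/ k)) =
    \sum_(0 <= a < N) \sum_(0 <= b < N) \sum_(0 <= r < k) \sum_(0 <= s < k) T a r b s.
  rewrite /ap3 sum_blocks; apply: eq_bigr => a _; rewrite [RHS]exchange_big /=.
  by apply: eq_bigr => r _; rewrite sum_blocks.
have -> : k%:R ^+ 2 * ap3 N H = \sum_(0 <= a < N) \sum_(0 <= b < N)
    \sum_(0 <= r < k) \sum_(0 <= s < k) H a * H (a + b)%N * H (a + b + b)%N.
  rewrite /ap3 mulr_sumr; apply: eq_bigr => a _; rewrite mulr_sumr; apply: eq_bigr => b _.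
  by rewrite !sumr_const_nat !subn0; ring.
have -> : 3 * e * (N * k)%:R ^+ 2 = N%:R * N%:R * (k%:R * k%:R * (3 * e)).
  by rewrite natrM; ring.
apply: dist_sum2_le => a b _ _; apply: dist_sum2_le => r s rk sk.
have -> : T a r b s = H a * H (a + b + (r + s) %/ k)%N * H (a + b + b + (r + s + s) %/ k)%N.
  congr (H _ * H _ * H _).
  - by rewrite divnMDl // divn_small ?addn0.
  - by rewrite addnACA -mulnDl divnMDl.
  - have -> : (a * k + r + (b * k + s) + (b * k + s) = (a + b + b) * k + (r + s + s))%N.
      by rewrite !mulnDl; lia.
    by rewrite divnMDl.
apply: le_trans (dist_prod3_le _ _ _ _ _ _) _ => //.
have h1 : ((r + s) %/ k <= 1)%N by rewrite -ltnS ltn_divLR //; lia.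
have h2 : ((r + s + s) %/ k <= 2)%N by rewrite -ltnS ltn_divLR //; lia.
have := slow_add_le (a + b) h1; rewrite distrC => h3.
have := slow_add_le (a + b + b) h2; rewrite distrC => h4.
rewrite subrr normr0; lra.
Qed.

End Slow.

Lemma ap3_dist (R : realType) (e : R) (N : nat) (G G' : nat -> R) :
  (forall n, 0 <= G n <= 1) -> (forall n, 0 <= G' n <= 1) ->
  (forall n, `|G n - G' n| <= e) -> `|ap3 N G - ap3 N G'| <= 3 * e * N%:R ^+ 2.
Proof.
move=> G01 G01' GG'.
have -> : 3 * e * N%:R ^+ 2 = N%:R * N%:R * (3 * e) by ring.
apply: dist_sum2_le => n d _ _; apply: le_trans (dist_prod3_le _ _ _ _ _ _) _ => //.
have := GG' n; have := GG' (n + d)%N; have := GG' (n + d + d)%N; lra.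
Qed.

Section Transfer.
Variables (R : realType) (e : R) (p q : nat) (F : nat -> R).
Hypotheses (p0 : (0 < p)%N) (pq : (p <= q)%N).
Hypotheses (F01 : forall n, 0 <= F n <= 1) (Fslow : forall n, `|F n.+1 - F n| <= e).
Hypothesis Fper : forall n, F (n + p)%N = F n.

(** Point [y] of the common refinement into [p * q] points lies in the interval of index [y %/ q] on
    the [p] side and [y %/ p] on the [q] side. This is the mean of [F (y %/ q)] over the [m]-th
    interval of length [p]. *)
Definition transfer (m : nat) : R := p%:R^-1 * \sum_(0 <= x < p) F ((m * p + x) %/ q).

Let q0 : (0 < q)%N. Proof. exact: leq_trans p0 pq. Qed.
Let p0' : 0 < p%:R :> R. Proof. by rewrite ltr0n. Qed.
Let q0' : 0 < q%:R :> R. Proof. by rewrite ltr0n. Qed.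

Lemma average_bounds (G : nat -> R) (a b : R) : (forall x, (x < p)%N -> a <= G x <= b) ->
  a <= p%:R^-1 * \sum_(0 <= x < p) G x <= b.
Proof.
move=> Gab; rewrite mulrC ler_pdivlMr // ler_pdivrMr //.
have const c : c * p%:R = \sum_(0 <= x < p) c by rewrite sumr_const_nat subn0 mulr_natr.
rewrite !const; apply/andP; split; rewrite [leLHS]big_nat [leRHS]big_nat;
  by apply: ler_sum => x /= xp; case/andP: (Gab x xp).
Qed.

Lemma transfer01 m : 0 <= transfer m <= 1.
Proof. by apply: average_bounds => x _. Qed.

Lemma transfer_periodic m : transfer (m + q)%N = transfer m.
Proof.
rewrite /transfer; congr (_ * _); apply: eq_bigr => x _.
by rewrite mulnDl addnAC [(q * p)%N]mulnC divnDMl.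
Qed.

(** The averaging interval containing [x] has length [p <= q], so [slow_divn] compares [x] with each
    of its points. *)
Lemma transfer_dist x : `|F (x %/ q) - transfer (x %/ p)| <= e.
Proof.
have xE := divn_eq x p; have xp := ltn_pmod x p0.
suff /average_bounds/andP[h1 h2] : forall y, (y < p)%N ->
    F (x %/ q) - e <= F ((x %/ p * p + y) %/ q) <= F (x %/ q) + e.
  by apply/ler_normlP; rewrite /transfer; split; lra.
move=> y yp.
have : `|F (x %/ q) - F ((x %/ p * p + y) %/ q)| <= e.
  case: (leqP x (x %/ p * p + y)) => h.
    by apply: slow_divn => //; rewrite h /=; lia.
  by rewrite distrC; apply: slow_divn => //; lia.
by move=> /ler_normlP[h1 h2]; apply/andP; split; lra.
Qed.

Lemma transfer_slow m : `|transfer m.+1 - transfer m| <= e.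
Proof.
have -> : transfer m.+1 - transfer m = p%:R^-1 *
    \sum_(0 <= x < p) (F ((m.+1 * p + x) %/ q) - F ((m * p + x) %/ q)).
  by rewrite sumrB mulrBr.
suff /average_bounds/andP[h1 h2] : forall x, (x < p)%N ->
    - e <= F ((m.+1 * p + x) %/ q) - F ((m * p + x) %/ q) <= e.
  by apply/ler_normlP; split; lra.
move=> x xp.
have : `|F ((m * p + x) %/ q) - F ((m.+1 * p + x) %/ q)| <= e.
  by apply: slow_divn => //; rewrite mulSn; lia.
by move=> /ler_normlP[h1 h2]; apply/andP; split; lra.
Qed.

(** Both sides are the mean of [F (y %/ q)] over [y < p * q], cut into [q] blocks of length [p] or
    into [p] blocks of length [q]. *)
Lemma sum_transfer :
  q%:R^-1 * \sum_(0 <= m < q) transfer m = p%:R^-1 * \sum_(0 <= a < p) F a.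
Proof.
rewrite /transfer -mulr_sumr -(sum_blocks q p (fun y => F (y %/ q))) mulnC sum_blocks mulrCA.
congr (_ * _).
rewrite mulr_sumr; apply: eq_bigr => a _.
rewrite big_nat (eq_bigr (fun=> F a)) => [|x /= xq]; last first.
  by rewrite divnMDl // divn_small ?addn0.
by rewrite -big_nat sumr_const_nat subn0 -[X in _ * X]mulr_natl mulKf ?gt_eqF.
Qed.

(** Both counts are lifted to length [p * q], where the two lifted functions differ by at most [e]
    pointwise. The two lifts and the comparison cost [3 * e] each after normalisation. *)
Lemma ap3_transfer :
  `|(q%:R ^+ 2)^-1 * ap3 q transfer - (p%:R ^+ 2)^-1 * ap3 p F| <= 9 * e.
Proof.
have h1 := ap3_blocks F01 Fslow p q0.
have h2 := ap3_blocks transfer01 transfer_slow q p0.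
have h3 : `|ap3 (p * q) (fun x => F (x %/ q)) -
    ap3 (p * q) (fun x => transfer (x %/ p))| <= 3 * e * (p * q)%:R ^+ 2.
  by apply: ap3_dist => // x; [exact: transfer01 | exact: transfer_dist].
rewrite [(q * p)%N]mulnC in h2.
have pq0 : 0 < (p * q)%:R ^+ 2 :> R by rewrite exprn_gt0 // ltr0n muln_gt0 p0.
rewrite -(ler_pM2r pq0) -[X in _ * X <= _]gtr0_norm // -normrM.
have -> : ((q%:R ^+ 2)^-1 * ap3 q transfer - (p%:R ^+ 2)^-1 * ap3 p F) * (p * q)%:R ^+ 2 =
    p%:R ^+ 2 * ap3 q transfer - q%:R ^+ 2 * ap3 p F.
  by rewrite natrM; field; rewrite !gt_eqF.
move: h1 h2 h3; move: (ap3 (p * q) _) (ap3 (p * q) _) => u v.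
move=> /ler_normlP[a1 a2] /ler_normlP[a3 a4] /ler_normlP[a5 a6].
by apply/ler_normlP; split; lra.
Qed.

End Transfer.

Lemma periodic_modn (T : Type) (q : nat) (g : nat -> T) :
  (forall n, g (n + q)%N = g n) -> forall n, g (n %% q)%N = g n.
Proof.
move=> gq n; rewrite {2}(divn_eq n q); elim: (n %/ q)%N => [|k IH].
  by rewrite mul0n add0n.
by rewrite mulSnr addnAC gq.
Qed.

Lemma Lambda3_transfer (R : realType) (e : R) (p q : nat) (h : 'Z_p -> R) :
  (1 < p)%N -> (p <= q)%N -> (forall x, 0 <= h x <= 1) ->
  (forall x, `|h (x + 1) - h x| <= e) ->
  exists g : 'Z_q -> R, [/\ forall x, 0 <= g x <= 1, expect g = expect h &
    `|Lambda3 g - Lambda3 h| <= 9 * e].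
Proof.
move=> p1 pq h01 hslow; have p0 := ltnW p1; have q1 := leq_trans p1 pq.
pose F (n : nat) := h n%:R.
have F01 n : 0 <= F n <= 1 by exact: h01.
have Fslow n : `|F n.+1 - F n| <= e by rewrite /F mulrSr.
have Fper n : F (n + p)%N = F n.
  by rewrite /F -(Zp_nat_mod p1) modnDr Zp_nat_mod.
pose g (x : 'Z_q) := transfer p q F x.
(* The terms [n + d] and [n + d + d] can exceed [q], so agreement is needed at all naturals and not
   only at representatives; periodicity gives it. *)
have gE (n : nat) : g n%:R = transfer p q F n.
  rewrite /g val_Zp_nat //; apply: periodic_modn => m.
  exact: (transfer_periodic p0 pq Fper).
exists g; split.
- by move=> x; exact: transfer01.
- rewrite /expect !sum_Zp // -(sum_transfer F p0 pq); congr (_ * _).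
  by apply: eq_bigr => i _; exact: gE.
- rewrite !Lambda3_ap3 // (_ : (fun n => g n%:R) = transfer p q F); last exact: funext.
  exact: ap3_transfer.
Qed.

Lemma Lambda3_transfer_primes (R : realType) (eps : R) : 0 < eps ->
  exists M : nat, forall p q : nat, prime p -> (M <= p)%N -> (p <= q)%N ->
    forall f : 'Z_p -> R, (forall x, 0 <= f x <= 1) ->
    exists g : 'Z_q -> R, [/\ forall x, 0 <= g x <= 1, expect g = expect f &
      Lambda3 g <= Lambda3 f + eps].
Proof.
(* One tenth of [eps] pays for the smoothing and nine tenths for the transfer. *)
move=> e0; have e10 : 0 < eps / 10 by lra.
have [M HM] := slow_approximation e10; exists M => p q pr Mp pq f f01.
have [h [h01 hf hslow /ler_normlP[h1 h2]]] := HM p pr Mp f f01.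
have [g [g01 gh /ler_normlP[g1 g2]]] := Lambda3_transfer (prime_gt1 pr) pq h01 hslow.
by exists g; split => //; [rewrite gh | lra].
Qed.

(** * Convergence of [rho] *)

Section Rho.
Variables (R : realType) (ups : R).
Hypothesis ups1 : ups <= 1.

Lemma famF_cst1 (N : nat) : (1 < N)%N -> famF ups (fun _ : 'Z_N => 1 : R).
Proof.
move=> N1; split => [_|]; first by rewrite ler01 lexx.
rewrite /expect sum_Zp // sumr_const_nat subn0 mulVf //.
by rewrite pnatr_eq0 -lt0n ltnW.
Qed.

Lemma Lambda3_ge0 (N : nat) (f : 'Z_N -> R) : (forall x, 0 <= f x) -> 0 <= Lambda3 f.
Proof.
move=> f0; rewrite mulr_ge0 ?invr_ge0 ?sqr_ge0 //.
by apply: sumr_ge0 => n _; apply: sumr_ge0 => d _; rewrite !mulr_ge0.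
Qed.

Lemma Lambda3_famF_lbound (N : nat) :
  lbound [set Lambda3 f | f in @famF R N ups] 0.
Proof. by move=> _ [f [f01 _] <-]; apply: Lambda3_ge0 => x; case/andP: (f01 x). Qed.

Lemma rho_le (N : nat) (f : 'Z_N -> R) : famF ups f -> rho ups N <= Lambda3 f.
Proof.
move=> fF; apply: ge_inf; last by exists f.
by exists 0; exact: Lambda3_famF_lbound.
Qed.

(** The constant function 1 shows that the family is nonempty, so [inf] is a true greatest lower
    bound and not a default value. *)
Lemma le_rho (N : nat) (c : R) : (1 < N)%N ->
  (forall f : 'Z_N -> R, famF ups f -> c <= Lambda3 f) -> c <= rho ups N.
Proof.
move=> N1 cf; apply: lb_le_inf => [|_ [f fF <-]]; last exact: cf.
by exists (Lambda3 (fun _ : 'Z_N => 1 : R)), (fun=> 1); first exact: famF_cst1.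
Qed.

Lemma rho_ge0 (N : nat) : (1 < N)%N -> 0 <= rho ups N.
Proof. by move=> N1; apply: le_rho => // f fF; apply: Lambda3_famF_lbound; exists f. Qed.

Lemma rho_le1 (N : nat) : (1 < N)%N -> rho ups N <= 1.
Proof.
move=> N1; apply: le_trans (rho_le (famF_cst1 N1)) _.
rewrite Lambda3_ap3 // /ap3.
under eq_bigr do under eq_bigr do rewrite !mulr1.
rewrite sumr_const_nat subn0 sumr_const_nat subn0 -mulrnA mulnn natrX mulVf //.
by rewrite expf_neq0 // pnatr_eq0 -lt0n ltnW.
Qed.

Lemma rho_almost_nonincreasing (eps : R) : 0 < eps ->
  exists M : nat, forall p q : nat, prime p -> prime q -> (M <= p)%N -> (p <= q)%N ->
    rho ups q <= rho ups p + eps.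
Proof.
move=> /Lambda3_transfer_primes[M HM]; exists M => p q pr qr Mp pq.
(* It suffices that [rho ups q - eps] bounds [Lambda3] from below on the family over [Z_p]; the
   transferred [g] has the same mean as [f], hence lies in the family over [Z_q]. *)
rewrite -lerBlDr; apply: le_rho (prime_gt1 pr) _ => f [f01 fups].
have [g [g01 gf gL]] := HM p q pr Mp pq f f01.
rewrite lerBlDr; apply: le_trans gL; apply: rho_le.
by split; last by rewrite gf.
Qed.

End Rho.

(** The limit is the lower limit along [P], written as the supremum over [M] of the infima of the
    tails [S M]. *)
Lemma almost_nonincreasing_cvg (R : realType) (P : pred nat) (u : nat -> R) :
  (forall M : nat, exists2 n, P n & (M <= n)%N) -> (forall n, P n -> 0 <= u n <= 1) ->
  (forall eps : R, 0 < eps -> exists M : nat, forall m n : nat,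
     P m -> P n -> (M <= m)%N -> (m <= n)%N -> u n <= u m + eps) ->
  exists l : R, forall eps : R, 0 < eps ->
    exists M : nat, forall n : nat, P n -> (M <= n)%N -> `|u n - l| < eps.
Proof.
move=> Pinf u01 udec.
pose S (M : nat) := [set u n | n in [set n | P n /\ (M <= n)%N]].
have S_lb M : has_lbound (S M).
  by exists 0 => _ [n [Pn _] <-]; case/andP: (u01 n Pn).
have S_ex M : S M !=set0 by have [n Pn Mn] := Pinf M; exists (u n), n.
have S_le1 M : inf (S M) <= 1.
  have [n Pn Mn] := Pinf M; apply: (@le_trans _ _ (u n)); last by case/andP: (u01 n Pn).
  by apply: ge_inf => //; exists n.
pose I := [set inf (S M) | M in [set: nat]].
have I_sup : has_sup I.
  by split; [exists (inf (S 0%N)), 0%N | exists 1 => _ [M _ <-]].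
exists (sup I) => eps e0; have e2 : 0 < eps / 2 by lra.
have [M0 HM0] := udec (eps / 2) e2.
(* Upper bound: one value near the infimum of its tail keeps all later values below [sup I + eps],
   by almost monotonicity. *)
have [n0 [Pn0 M0n0] un0] : exists2 n, P n /\ (M0 <= n)%N & u n < inf (S M0) + eps / 2.
  have [_ [n Pn <-] un] := inf_adherent e2 (conj (S_ex M0) (S_lb M0)).
  by exists n.
have IM0 : inf (S M0) <= sup I by apply: ub_le_sup; [case: I_sup | exists M0].
(* Lower bound: some tail has its infimum above [sup I - eps]. *)
have [_ [M1 _ <-] IM1] := sup_adherent e0 I_sup.
exists (maxn n0 M1) => n Pn; rewrite geq_max => /andP[n0n M1n].
have h1 := HM0 n0 n Pn0 Pn M0n0 n0n.
have h2 : inf (S M1) <= u n by apply: ge_inf => //; exists n.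
by apply/ltr_normlP; split; lra.
Qed.

Theorem theorem1 (R : realType) (ups : R) (hups : 0 < ups <= 1) :
  exists l : R, forall eps : R, 0 < eps ->
    exists M : nat, forall p : nat, prime p -> (M <= p)%N ->
      `| rho ups p - l | < eps.
Proof.
have /andP[_ ups1] := hups.
apply: (@almost_nonincreasing_cvg R prime (rho ups)).
- by move=> M; have [p Mp pr] := prime_above M; exists p => //; exact: ltnW.
- by move=> p /prime_gt1 p1; rewrite rho_ge0 ?rho_le1.
- exact: rho_almost_nonincreasing.
Qed.
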